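(* Call an integral polyhedron GCW (every integral polyhedron is GCW), ICW if all of its circuit walks are integral, VCW if all of its circuit walks are vertex walks, and ECW if all of its circuit walks are edge walks. Then every ECW polyhedron is VCW, every VCW polyhedron is ICW, every ICW polyhedron is GCW, and these four classes are pairwise distinct: there exist integral polyhedra that are GCW but not ICW, integral polyhedra that are ICW but not VCW, integral polyhedra that are VCW but not ECW, and integral polyhedra that are ECW.
   Context: An integral polyhedron is a polyhedron all of whose vertices have integer coordinates. For a polyhedron $P=\{x\in\mathbb R^n: Ax=b,\ Bx\le d\}$ with rational matrices $A,B$, the set of circuits $\mathcal C(A,B)$ consists of all $g\in\ker(A)\setminus\{0\}$ with coprime integer components such that the support of $Bg$ is inclusion-minimal among the supports of the vectors $Bx$, $x\in\ker(A)\setminus\{0\}$. Circuits depend on the representation; when a polyhedron is not given by an inequality description, its circuits are taken with respect to a minimal representation, i.e. one in which every inequality defines a facet. For vertices $v^{(1)},v^{(2)}$ of $P$, a circuit walk of length $k$ is a sequence $v^{(1)}=y^{(0)},\dots,y^{(k)}=v^{(2)}$ such that for $i=0,\dots,k-1$: $y^{(i)}\in P$; $y^{(i+1)}=y^{(i)}+\alpha_i g^{(i)}$ for some $g^{(i)}\in\mathcal C(A,B)$ and $\alpha_i>0$; and $y^{(i)}+\alpha g^{(i)}\notin P$ for all $\alpha>\alpha_i$. The walk is integral if every $y^{(i)}$ is an integer vector, a vertex walk if every $y^{(i)}$ is a vertex of $P$, and an edge walk if it is a vertex walk and each segment $[y^{(i)},y^{(i+1)}]$ is an edge of $P$. *)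

(* Defs.v *)
From HB Require Import structures.
From mathcomp Require Import all_boot all_order all_algebra.
From mathcomp Require Import classical_sets reals.

Set Implicit Arguments.
Unset Strict Implicit.
Unset Printing Implicit Defensive.

Import Order.TTheory GRing.Theory Num.Theory.

Local Open Scope classical_set_scope.
Local Open Scope ring_scope.

(* {x | A x = b, B x <= d} with A, B rational. Circuits depend on the
   description and not only on the set it describes, so the description is
   what is carried around. *)
Record hrep (R : realType) (n : nat) := Hrep {
  num_eq : nat;
  num_ineq : nat;
  eqmx : 'M[rat]_(num_eq, n);
  eqrhs : 'cV[R]_num_eq;
  ineqmx : 'M[rat]_(num_ineq, n);
  ineqrhs : 'cV[R]_num_ineq }.

Section Sets.
Variables (R : realType) (n : nat).
Implicit Types (X F : set 'cV[R]_n) (u v x : 'cV[R]_n).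

Definition integral_vector x : Prop := forall j, x j 0 \is a Num.int.

Definition face X F : Prop :=
  F !=set0 /\
  exists (c : 'rV[R]_n) (delta : R),
    (forall x, X x -> (c *m x) 0 0 <= delta) /\
    F = [set x | X x /\ (c *m x) 0 0 = delta].

Definition affinely_independent (k : nat) (y : 'I_k.+1 -> 'cV[R]_n) : bool :=
  row_free (\matrix_(i < k) (y (lift ord0 i) - y ord0)^T).

Definition has_dim X (k : nat) : Prop :=
  (exists y : 'I_k.+1 -> 'cV[R]_n,
     (forall i, X (y i)) /\ affinely_independent y) /\
  (forall y : 'I_k.+2 -> 'cV[R]_n,
     (forall i, X (y i)) -> ~~ affinely_independent y).

(* A vertex is a face of dimension 0, i.e. a one-point face. *)
Definition vertex X v : Prop := face X [set v].

Definition edge X F : Prop := face X F /\ has_dim F 1.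

Definition facet X F : Prop :=
  face X F /\ exists k, has_dim F k /\ has_dim X k.+1.

Definition segment u v : set 'cV[R]_n :=
  [set x | exists t : R, 0 <= t <= 1 /\ x = (1 - t) *: u + t *: v].

End Sets.

Section Circuits.
Variables (R : realType) (n : nat) (P : hrep R n).

Definition eqmap (x : 'cV[R]_n) : 'cV[R]_(num_eq P) :=
  map_mx ratr (eqmx P) *m x.

Definition ineqmap (x : 'cV[R]_n) : 'cV[R]_(num_ineq P) :=
  map_mx ratr (ineqmx P) *m x.

Definition polyhedron : set 'cV[R]_n :=
  [set x | eqmap x = eqrhs P /\ forall i, ineqmap x i 0 <= ineqrhs P i 0].

Definition minimal_representation : Prop :=
  forall i, facet polyhedron
    [set x | polyhedron x /\ ineqmap x i 0 = ineqrhs P i 0].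

Definition supp (m : nat) (z : 'cV[R]_m) : {set 'I_m} :=
  finset (fun i => z i 0 != 0).

Definition circuit (g : 'cV[R]_n) : Prop :=
  [/\ eqmap g = 0,
      g != 0,
      exists z : 'cV[int]_n,
        g = map_mx intr z /\ \big[gcdn/0%N]_j `|z j 0%R|%N = 1%N
    & forall x, eqmap x = 0 -> x != 0 ->
        ~~ (supp (ineqmap x) \proper supp (ineqmap g))].

(* Only y 0, ..., y k matter. *)
Definition circuit_walk (k : nat) (y : nat -> 'cV[R]_n) : Prop :=
  [/\ vertex polyhedron (y 0%N),
      vertex polyhedron (y k)
    & forall i, (i < k)%N ->
        polyhedron (y i) /\
        exists (g : 'cV[R]_n) (alpha : R),
          [/\ circuit g,
              0 < alpha,
              y i.+1 = y i + alpha *: g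
            & forall a, alpha < a -> ~ polyhedron (y i + a *: g)]].

Definition integral_walk (k : nat) (y : nat -> 'cV[R]_n) : Prop :=
  forall i, (i <= k)%N -> integral_vector (y i).

Definition vertex_walk (k : nat) (y : nat -> 'cV[R]_n) : Prop :=
  forall i, (i <= k)%N -> vertex polyhedron (y i).

Definition edge_walk (k : nat) (y : nat -> 'cV[R]_n) : Prop :=
  vertex_walk k y /\
  forall i, (i < k)%N -> edge polyhedron (segment (y i) (y i.+1)).

Definition integral_polyhedron : Prop :=
  forall v, vertex polyhedron v -> integral_vector v.

Definition GCW : Prop := integral_polyhedron.

Definition ICW : Prop :=
  integral_polyhedron /\ forall k y, circuit_walk k y -> integral_walk k y.

Definition VCW : Prop :=
  integral_polyhedron /\ forall k y, circuit_walk k y -> vertex_walk k y.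

Definition ECW : Prop :=
  integral_polyhedron /\ forall k y, circuit_walk k y -> edge_walk k y.

End Circuits.

(* Main.v *)
(* Four lattice polygons separate the classes. Every circuit of a polygon is
   orthogonal to one of the facet normals. If all 2x2 minors of the normals are
   0, 1 or -1, then a maximal circuit step from a lattice point has integral
   length, so all circuit walks are integral; a step always ends on the boundary.
   - Kite (0,0), (1,0), (2,2), (0,1): the walk (1,0), (1,3/2), (2,2) is not
     integral.
   - Trapezoid (0,0), (2,0), (1,1), (0,1): unimodular, but the walk (0,1), (1,0),
     (2,0) passes through the non-vertex (1,0).
   - Hexagon |x|, |y|, |x - y| <= 1: unimodular, and its only lattice points
     are the vertices and the origin, which is interior, so walks visit only
     vertices; the step from (1,1) to (-1,-1) crosses the interior.
   - Unit triangle: unimodular, its lattice points are its vertices, and any two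
     of them span an edge. *)
Require Import Defs.
From HB Require Import structures.
From mathcomp Require Import all_boot all_order all_algebra.
From mathcomp Require Import classical_sets reals.
From mathcomp Require Import ring lra zify.

Set Implicit Arguments.
Unset Strict Implicit.
Unset Printing Implicit Defensive.

Import Order.TTheory GRing.Theory Num.Theory.

Local Open Scope classical_set_scope.
Local Open Scope ring_scope.

(** * Lattice polygons as integer data, with decidable tests *)

(* [(a, b, c)] stands for the inequality [a x + b y <= c]. *)
Definition con := (int * int * int)%type.

Definition idet (t u : con) : int := t.1.1 * u.1.2 - t.1.2 * u.1.1.

Definition ilin (t : con) (p : int * int) : int := t.1.1 * p.1 + t.1.2 * p.2.

Definition ipolygon (s : seq con) (p : int * int) : bool :=
  all (fun t : con => ilin t p <= t.2) s.

(** Boolean counterpart of [vertexP] at lattice points, so that vertices of concrete polygons are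
    certified by computation. *)
Definition ivertex (s : seq con) (p : int * int) : bool :=
  ipolygon s p &&
  has (fun t => has (fun u =>
    [&& ilin t p == t.2, ilin u p == u.2 & idet t u != 0]) s) s.

Definition unimodular (s : seq con) : bool :=
  all (fun t : con => (t.1.1 != 0) || (t.1.2 != 0)) s &&
  all (fun t => all (fun u => `|idet t u| <= 1) s) s.

(** * Polygons as representations in the plane *)

Section Polygon.
Variable R : realType.
Implicit Types (s : seq con) (t u : con) (v w g d : 'cV[R]_2).

Definition vec2 (a b : R) : 'cV[R]_2 := \col_i (if i == 0 then a else b).

Definition ivec (p : int * int) : 'cV[R]_2 := vec2 p.1%:~R p.2%:~R.

Definition lin t v : R := t.1.1%:~R * v 0 0 + t.1.2%:~R * v 1 0.

(** There are no equations, so every nonzero vector of the plane competes in the minimality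
    condition for circuits. *)
Definition polygon s : hrep R 2 :=
  @Hrep R 2 0 (size s) 0 0
    (\matrix_(i, j) (let t := nth (0, 0, 0) s i in
                     if j == 0 then t.1.1 else t.1.2)%:~R)
    (\col_i (nth (0, 0, 0) s i).2%:~R).

Lemma vec2E0 a b : vec2 a b 0 0 = a.
Proof. by rewrite mxE. Qed.

Lemma vec2E1 a b : vec2 a b 1 0 = b.
Proof. by rewrite mxE. Qed.

Lemma col2P v w : v 0 0 = w 0 0 -> v 1 0 = w 1 0 -> v = w.
Proof.
move=> h0 h1; apply/matrixP => i j; rewrite (ord1 j).
have [->|->] // : i = 0 \/ i = 1.
by case: i => [[|[|//]] ?]; [left | right]; apply: val_inj.
Qed.

Lemma mul_row_lin t v :
  ((\row_j (if j == 0 then t.1.1 else t.1.2)%:~R) *m v) 0 0 = lin t v.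
Proof.
rewrite mxE big_ord_recl big_ord1 !mxE /=.
by rewrite /lin; congr (_ + _ * v _ _); apply: val_inj.
Qed.

Lemma linD t v w : lin t (v + w) = lin t v + lin t w.
Proof. rewrite /lin !mxE; ring. Qed.

Lemma linZ t a v : lin t (a *: v) = a * lin t v.
Proof. rewrite /lin !mxE; ring. Qed.

Lemma lin_ivec t p : lin t (ivec p) = (ilin t p)%:~R.
Proof. by rewrite /lin vec2E0 vec2E1 /ilin rmorphD !rmorphM. Qed.

Lemma eqmap_polygon s v : eqmap (polygon s) v = 0.
Proof. by apply/matrixP => -[]. Qed.

Lemma ineqmap_polygon s v (i : 'I_(size s)) :
  ineqmap (polygon s) v i 0 = lin (nth (0, 0, 0) s i) v.
Proof.
rewrite /ineqmap mxE big_ord_recl big_ord1 !mxE /= !ratr_int.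
by rewrite /lin; congr (_ + _ * v _ _); apply: val_inj.
Qed.

Lemma polygonP s v :
  polyhedron (polygon s) v <-> {in s, forall t, lin t v <= t.2%:~R}.
Proof.
split=> [[_ h] t /(nthP (0, 0, 0)) [i lt_i <-]|h].
  by have := h (Ordinal lt_i); rewrite ineqmap_polygon mxE.
split; first by apply/matrixP => -[].
by move=> i; rewrite ineqmap_polygon mxE; apply/h/mem_nth.
Qed.

Lemma polygon_ivec s p : ipolygon s p <-> polyhedron (polygon s) (ivec p).
Proof.
rewrite polygonP; split=> [/allP h t /h|h]; first by rewrite lin_ivec ler_int.
by apply/allP => t /h; rewrite lin_ivec ler_int.
Qed.

(** Cramer's rule: the determinant times a coordinate is a combination of the values of the two
    forms. *)
Lemma idet_neq0_eq t u v w : idet t u != 0 ->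
  lin t v = lin t w -> lin u v = lin u w -> v = w.
Proof.
rewrite /lin -(intr_eq0 R) rmorphB !rmorphM /= => det ht hu.
apply: col2P; apply: (mulfI det).
  have := congr1 ( *%R u.1.2%:~R) ht; have := congr1 ( *%R t.1.2%:~R) hu; lra.
have := congr1 ( *%R u.1.1%:~R) ht; have := congr1 ( *%R t.1.1%:~R) hu; lra.
Qed.

(** * Faces and vertices of a polygon *)

(** The functional is maximal at [x], and its changes along [d] and [- d] are opposite, so both
    vanish. This serves below to refute that a given set is a face. *)
Lemma face_midpoint n (X F : set 'cV[R]_n) (x d : 'cV[R]_n) :
  face X F -> F x -> X (x + d) -> X (x - d) -> F (x + d).
Proof.
move=> [_ [c [delta [le_c ->]]]] /= [_ cx] Xp Xm; split=> //.
have := le_c _ Xp; have := le_c _ Xm.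
rewrite mulmxBr mulmxDr; move: cx; rewrite !mxE; lra.
Qed.

(** Only constraints that are slack at [v] can increase along [d], and finitely many positive slacks
    leave room for a common step. *)
Lemma move_inside s v d : polyhedron (polygon s) v ->
  {in s, forall t, lin t v = t.2%:~R -> lin t d <= 0} ->
  exists2 e : R, 0 < e & forall a, 0 <= a <= e ->
    polyhedron (polygon s) (v + a *: d).
Proof.
move=> /polygonP vP dP.
have [e e_gt0 he] : exists2 e : R, 0 < e & forall a, 0 <= a <= e ->
    {in s, forall t, lin t (v + a *: d) <= t.2%:~R}.
  elim: s vP dP => [|t s IH] vP dP; first by exists 1.
  case: IH => [u us|u us|e e_gt0 he].
  - by apply: vP; rewrite inE us orbT.
  - by apply: dP; rewrite inE us orbT.
  have vt := vP _ (mem_head t s); have dt := dP _ (mem_head t s).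
  have [td_le0|td_gt0] := leP (lin t d) 0.
    exists e => // a ha u; rewrite inE => /predU1P[->|]; last exact: he.
    rewrite linD linZ -[t.2%:~R]addr0 lerD // mulr_ge0_le0 //.
    by case/andP: ha.
  have vt_lt : lin t v < t.2%:~R.
    by rewrite lt_neqAle vt andbT; apply: contraTneq td_gt0 => /dt; case: ltgtP.
  (* The new constraint allows a step of its slack divided by its growth rate. *)
  exists (Num.min e ((t.2%:~R - lin t v) / lin t d)).
    by rewrite lt_min e_gt0 divr_gt0 // subr_gt0.
  move=> a; rewrite le_min => /and3P[a_ge0 ae at_] u.
  rewrite inE => /predU1P[->|]; last by apply: he; rewrite a_ge0.
  by rewrite linD linZ addrC -lerBrDr -ler_pdivlMr.
by exists e => // a /he /polygonP.
Qed.

Lemma vertex_mem n (X : set 'cV[R]_n) (v : 'cV[R]_n) : vertex X v -> X v.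
Proof.
move=> [_ [c [delta [_ e]]]].
by have : [set v] v by []; rewrite e => -[].
Qed.

(** Otherwise all tight constraints are constant along [d], so [v] can move a little both ways,
    against [face_midpoint]. *)
Lemma vertex_tight s v d : vertex (polyhedron (polygon s)) v -> d != 0 ->
  exists t, [/\ t \in s, lin t v = t.2%:~R & lin t d != 0].
Proof.
move=> vtx d_neq0; have vP := vertex_mem vtx.
have [/hasP[t ts /andP[/eqP tv td]]|/hasPn nt] :=
  boolP (has (fun t => (lin t v == t.2%:~R) && (lin t d != 0)) s).
  by exists t.
have d0 t : t \in s -> lin t v = t.2%:~R -> lin t d = 0.
  by move=> /nt + tv; rewrite tv eqxx /= negbK => /eqP.
have [|e e_gt0 he] := @move_inside s v d vP.
  by move=> t ts tv; rewrite d0.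
have [|f f_gt0 hf] := @move_inside s v (- d) vP.
  by move=> t ts tv; rewrite -scaleN1r linZ d0 // mulr0.
pose m := Num.min e f.
have m_gt0 : 0 < m by rewrite lt_min e_gt0.
have : [set v] (v + m *: d).
  apply: (face_midpoint vtx) => //.
    by apply: he; rewrite (ltW m_gt0) ge_min lexx.
  by rewrite -scalerN; apply: hf; rewrite (ltW m_gt0) ge_min lexx orbT.
move=> /(canRL (addKr _)); rewrite addNr => /eqP.
by rewrite scaler_eq0 (negPf d_neq0) orbF gt_eqF.
Qed.

(** A vertex is a point of the polygon on two non-parallel boundary lines. Conversely, the sum of
    the two normals is maximal only where both constraints are tight, which is a single point. *)
Lemma vertexP s v : vertex (polyhedron (polygon s)) v <->
  polyhedron (polygon s) v /\
  exists t u, [/\ t \in s, u \in s, lin t v = t.2%:~R, lin u v = u.2%:~R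
                & idet t u != 0].
Proof.
split=> [vtx|[vP [t [u [ts us tv uv det]]]]].
  split; first exact: vertex_mem.
  (* Testing with the first unit vector gives a tight [t] with nonzero first coefficient, so that
     its rotated normal below is nonzero. *)
  have [|t [ts tv t0]] := @vertex_tight s v (vec2 1 0) vtx.
    by apply/eqP => /matrixP/(_ 0 0)/eqP; rewrite vec2E0 mxE oner_eq0.
  have {}t0 : t.1.1 != 0.
    move: t0; rewrite /lin vec2E0 vec2E1 mulr0 addr0 mulr1.
    by rewrite intr_eq0.
  (* On the direction of the line of [t], the form of [u] takes the value [idet t u]. *)
  have [|u [us uv u0]] :=
      @vertex_tight s v (vec2 (- t.1.2%:~R) t.1.1%:~R) vtx.
    apply/eqP => /matrixP/(_ 1 0)/eqP; rewrite vec2E1 mxE intr_eq0.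
    by rewrite (negPf t0).
  exists t, u; split=> //; move: u0.
  rewrite /lin vec2E0 vec2E1 -(intr_eq0 R) /idet rmorphB !rmorphM /=.
  by apply: contraNneq => h; apply/eqP; rewrite -[RHS]h; ring.
split; first by exists v.
exists (\row_j (if j == 0 then t.1.1 else t.1.2)%:~R +
        \row_j (if j == 0 then u.1.1 else u.1.2)%:~R).
exists (t.2%:~R + u.2%:~R).
have cE x : ((\row_j (if j == 0 then t.1.1 else t.1.2)%:~R +
    \row_j (if j == 0 then u.1.1 else u.1.2)%:~R) *m x) 0 0
    = lin t x + lin u x.
  by rewrite mulmxDl -!mul_row_lin [LHS]mxE.
split=> [x|].
  by move=> /polygonP xP; rewrite cE lerD // xP.
rewrite eqEsubset; split=> x /=; first by move->; rewrite cE tv uv.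
rewrite cE => -[/polygonP xP e].
have := xP _ ts; have := xP _ us => xu xt.
by apply: (idet_neq0_eq det); rewrite ?tv ?uv; lra.
Qed.

Lemma ivertex_vertex s p :
  ivertex s p -> vertex (polyhedron (polygon s)) (ivec p).
Proof.
case/andP=> /polygon_ivec pP /hasP[t ts /hasP[u us /and3P[/eqP tp /eqP up det]]].
by apply/vertexP; split=> //; exists t, u; rewrite !lin_ivec tp up.
Qed.

(** * Maximal steps and circuits of a polygon *)

(** If no tight constraint grows along [g] at the end point, [move_inside] prolongs the step beyond
    [alpha]. *)
Lemma blocking s v g alpha : 0 < alpha ->
  polyhedron (polygon s) (v + alpha *: g) ->
  (forall a, alpha < a -> ~ polyhedron (polygon s) (v + a *: g)) ->
  exists t, [/\ t \in s, 0 < lin t g & lin t (v + alpha *: g) = t.2%:~R].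
Proof.
move=> a_gt0 wP maxa.
have [/hasP[t ts /andP[tg /eqP tw]]|/hasPn nt] :=
  boolP (has (fun t => (0 < lin t g) && (lin t (v + alpha *: g) == t.2%:~R)) s).
  by exists t.
have [|e e_gt0 /(_ e)] := @move_inside s _ g wP.
  by move=> t /nt + tw; rewrite tw eqxx andbT -leNgt.
rewrite lexx (ltW e_gt0) => /(_ isT); rewrite -addrA -scalerDl.
by move=> /maxa []; rewrite ltrDl.
Qed.

Lemma idet0_lin t u g : (t.1.1 != 0) || (t.1.2 != 0) ->
  idet t u = 0 -> lin t g = 0 -> lin u g = 0.
Proof.
move=> t0 /(congr1 (fun z : int => z%:~R : R)).
rewrite /idet rmorphB !rmorphM /= /lin => det tg.
case/orP: t0; rewrite -(intr_eq0 R) => /mulfI; apply; rewrite mulr0.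
  have := congr1 ( *%R u.1.1%:~R) tg; have := congr1 ( *%R (g 1 0)) det; lra.
have := congr1 ( *%R u.1.2%:~R) tg; have := congr1 ( *%R (g 0 0)) det; lra.
Qed.

(** Otherwise [g] has full support, while the direction of any boundary line has strictly smaller
    support. *)
Lemma circuit_orthogonal s g : s != [::] ->
  all (fun t : con => (t.1.1 != 0) || (t.1.2 != 0)) s ->
  circuit (polygon s) g -> exists2 t, t \in s & lin t g = 0.
Proof.
case: s => // t s _ nz [_ _ _ /(_ (vec2 (- t.1.2%:~R) t.1.1%:~R)) min_g].
have [/hasP[u us /eqP ug]|/hasPn nt] :=
  boolP (has (fun u => lin u g == 0) (t :: s)); first by exists u.
have tx : lin t (vec2 (- t.1.2%:~R) t.1.1%:~R) = 0.
  by rewrite /lin vec2E0 vec2E1; ring.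
have x_neq0 : vec2 (- t.1.2%:~R) t.1.1%:~R != 0 :> 'cV[R]_2.
  apply/eqP => /matrixP e; have := e 0 0; have := e 1 0.
  rewrite vec2E0 vec2E1 !mxE => /eqP + /eqP.
  rewrite oppr_eq0 !intr_eq0; case/andP: nz => + _.
  by case/orP => /negPf->.
case/negP: (min_g (eqmap_polygon _ _) x_neq0).
apply/properP; split.
  by apply/fintype.subsetP => i _; rewrite inE ineqmap_polygon nt // mem_nth.
exists ord0; rewrite !inE ineqmap_polygon /=.
  by rewrite nt // mem_head.
by rewrite negbK; apply/eqP.
Qed.

Lemma gcd_ord2 (z : 'cV[int]_2) :
  \big[gcdn/0%N]_j `|z j 0%R|%N = gcdn `|z 0%R 0%R|%N `|z 1%R 0%R|%N.
Proof.
rewrite big_ord_recl big_ord1.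
by congr (gcdn _ `|z _ _|%N); apply: val_inj.
Qed.

(** A vector of strictly smaller support is killed by [t] and by some constraint that does not kill
    [p]. That constraint is not parallel to [t], so the vector is zero. *)
Lemma circuit_ivec s t p : t \in s -> (t.1.1 != 0) || (t.1.2 != 0) ->
  ilin t p = 0 -> coprime `|p.1|%N `|p.2|%N -> circuit (polygon s) (ivec p).
Proof.
move=> ts t0 tp cop; split.
- exact: eqmap_polygon.
- apply/eqP => /matrixP e; have := e 0 0; have := e 1 0.
  rewrite vec2E0 vec2E1 !mxE => /eqP + /eqP.
  rewrite !intr_eq0 => /eqP p2 /eqP p1.
  by move: cop; rewrite p1 p2.
- exists (\col_i (if i == 0 then p.1 else p.2)); split.
    by apply: col2P; rewrite !mxE.
  by rewrite gcd_ord2 !mxE; apply/eqP.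
move=> x _ x_neq0; apply/negP => /properP[/fintype.subsetP sub [i gi xi]].
have tx : lin t x = 0.
  case/(nthP (0, 0, 0)): ts tp => j lt_j <- tp.
  have := sub (Ordinal lt_j); rewrite !inE !ineqmap_polygon /= lin_ivec tp eqxx.
  by case: eqP => // _ /(_ isT).
move: gi xi; rewrite !inE !ineqmap_polygon negbK => gi /eqP ux.
have det : idet t (nth (0, 0, 0) s i) != 0.
  apply: contraNneq gi => det; apply/eqP.
  by apply: (idet0_lin t0 det); rewrite lin_ivec tp.
case/eqP: x_neq0; apply: (idet_neq0_eq det).
  by rewrite tx /lin !mxE; ring.
by rewrite ux /lin !mxE; ring.
Qed.

(** * Integrality of vertices and of circuit walks *)

Lemma unimodular_idet s t u : unimodular s -> t \in s -> u \in s ->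
  idet t u != 0 -> idet t u = 1 \/ idet t u = -1.
Proof.
by case/andP=> _ /allP h /h /allP{}h /h; lia.
Qed.

Lemma integral_vectorP v : integral_vector v <-> exists p, v = ivec p.
Proof.
split=> [vZ|[p ->] j]; last first.
  by rewrite mxE; case: ifP => _; apply: intr_int.
have /intrP[a va] := vZ 0; have /intrP[b vb] := vZ 1.
by exists (a, b); apply: col2P; rewrite !mxE.
Qed.

Lemma cramer t u v : lin t v = t.2%:~R -> lin u v = u.2%:~R ->
  (idet t u)%:~R * v 0 0 = (t.2 * u.1.2 - u.2 * t.1.2)%:~R /\
  (idet t u)%:~R * v 1 0 = (u.2 * t.1.1 - t.2 * u.1.1)%:~R.
Proof.
rewrite /idet !rmorphB !rmorphM /= => <- <-; rewrite /lin; split; ring.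
Qed.

(** The divisibilities say that Cramer's quotients are integers for all pairs of non-parallel
    boundary lines, including those that meet outside the polygon. The test is decidable. *)
Lemma integral_polygon s :
  all (fun t => all (fun u => (idet t u != 0) ==>
    (idet t u %| t.2 * u.1.2 - u.2 * t.1.2)%Z &&
    (idet t u %| u.2 * t.1.1 - t.2 * u.1.1)%Z) s) s ->
  integral_polyhedron (polygon s).
Proof.
move=> /allP h v /vertexP[_ [t [u [ts us tv uv det]]]].
have /allP/(_ _ us) := h _ ts.
rewrite det => /andP[/dvdzP[a ea] /dvdzP[b eb]].
have [] := cramer tv uv; rewrite ea eb !rmorphM /= ![_ * (idet t u)%:~R]mulrC.
move: det; rewrite -(intr_eq0 R) => det /(mulfI det) va /(mulfI det) vb.
by apply/integral_vectorP; exists (a, b); apply: col2P; rewrite mxE.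
Qed.

Lemma circuit_walk_step s k (y : nat -> 'cV[R]_2) i :
  circuit_walk (polygon s) k y -> (i < k)%N ->
  exists g alpha t, [/\ circuit (polygon s) g,
    0 < alpha /\ y i.+1 = y i + alpha *: g,
    t \in s, 0 < lin t g & lin t (y i.+1) = t.2%:~R].
Proof.
move=> [_ yk step] lt_ik; have [_ [g [a [gC a_gt0 yS maxa]]]] := step _ lt_ik.
have yP : polyhedron (polygon s) (y i.+1).
  (* The definition of a walk puts only the points before the last one in the polygon; the last one
     is there as a vertex. *)
  have [/step[]//|le_k] := ltnP i.+1 k.
  have -> : i.+1 = k by apply/eqP; rewrite eqn_leq lt_ik.
  exact: vertex_mem.
rewrite yS in yP; have [t [ts tg ty]] := blocking a_gt0 yP maxa.
by exists g, a, t; rewrite yS.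
Qed.

(* The circuit [g] is orthogonal to the normal of some [t], so both components
   of [g] are multiples of the integer [u . g] up to sign as [idet t u = 1] or
   [-1]; coprimality forces [u . g = 1], and the step length is the integral
   slack of [u]. *)
Lemma unimodular_step s g t u v alpha : unimodular s ->
  circuit (polygon s) g -> t \in s -> lin t g = 0 ->
  u \in s -> 0 < lin u g -> integral_vector v ->
  lin u (v + alpha *: g) = u.2%:~R -> integral_vector (v + alpha *: g).
Proof.
move=> uni [_ _ [z [gz cop]] _] ts tg us ug /integral_vectorP[p vp] uv.
have gE : g = ivec (z 0 0, z 1 0) by apply: col2P; rewrite gz !mxE.
rewrite {}gE {gz} in tg ug uv *; set q := (z 0 0, z 1 0) in tg ug uv *.
have t0 : (t.1.1 != 0) || (t.1.2 != 0) by case/andP: uni => /allP /(_ _ ts).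
have det : idet t u != 0.
  by apply: contraTneq ug => /(idet0_lin t0)/(_ tg) ->; rewrite ltxx.
have {}det := unimodular_idet uni ts us det.
move: tg ug; rewrite !lin_ivec => /eqP; rewrite intr_eq0 ltr0z => /eqP tq uq.
have e0 : idet t u * q.1 = - t.1.2 * ilin u q.
  have := congr1 ( *%R u.1.2) tq; rewrite /idet /ilin; lia.
have e1 : idet t u * q.2 = t.1.1 * ilin u q.
  have := congr1 ( *%R u.1.1) tq; rewrite /idet /ilin; lia.
have d0 : (`|ilin u q| %| `|z 0%R 0%R|)%N.
  apply/dvdnP; exists `|t.1.2|%N; rewrite -abszM -[z 0 0]/q.1.
  by case: det e0 => ->; lia.
have d1 : (`|ilin u q| %| `|z 1%R 0%R|)%N.
  apply/dvdnP; exists `|t.1.1|%N; rewrite -abszM -[z 1 0]/q.2.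
  by case: det e1 => ->; lia.
have uq1 : ilin u q = 1.
  have : (`|ilin u q| %| 1)%N by rewrite -cop gcd_ord2 dvdn_gcd d0.
  by rewrite dvdn1; lia.
move: uv; rewrite vp linD linZ !lin_ivec uq1 mulr1 => /(canRL (addKr _)) ->.
rewrite [- _ + _]addrC -rmorphB; apply/integral_vectorP.
exists (p.1 + (u.2 - ilin u p) * q.1, p.2 + (u.2 - ilin u p) * q.2).
by apply: col2P; rewrite !mxE /= -rmorphM -rmorphD.
Qed.

(** Vertices are integral as the determinants in Cramer's rule are units. Induction along the walk
    then uses a constraint orthogonal to the circuit and one that blocks the step. *)
Lemma unimodular_ICW s : unimodular s -> ICW (polygon s).
Proof.
move=> uni; have vZ : integral_polyhedron (polygon s).
  apply: integral_polygon; apply/allP => t ts; apply/allP => u us.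
  apply/implyP => /(unimodular_idet uni ts us)[]->; first by rewrite !dvd1z.
  by rewrite !dvdzE abszN absz1 !dvd1n.
split=> // k y yW i; elim: i => [|i IH] lt_ik.
  by apply: vZ; case: yW.
have [g [a [u [gC [_ yS] us ug uy]]]] := circuit_walk_step yW lt_ik.
have s0 : s != [::] by case: (s) us.
have [t ts tg] := circuit_orthogonal s0 (proj1 (andP uni)) gC.
rewrite yS in uy *; apply: (unimodular_step uni gC ts tg us ug) => //.
exact/IH/ltnW.
Qed.

(** Each point after the first is integral and lies on the line of the constraint that blocked the
    step; by hypothesis such lattice points are vertices. *)
Lemma unimodular_VCW s : unimodular s ->
  (forall p, ipolygon s p -> has (fun t => ilin t p == t.2) s ->
     ivertex s p) ->
  VCW (polygon s).
Proof.
move=> uni sP; have [vZ wZ] := unimodular_ICW uni.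
split=> // k y yW [_|i lt_ik]; first by case: yW.
have [_ [_ [u [_ _ us _ uy]]]] := circuit_walk_step yW lt_ik.
have [_ yk step] := yW.
have [/step[]yP _|le_k] := ltnP i.+1 k; last first.
  by rewrite (_ : i.+1 = k) //; apply/eqP; rewrite eqn_leq lt_ik.
have /integral_vectorP[p yp] := wZ _ _ yW _ lt_ik.
rewrite yp in yP uy *; apply/ivertex_vertex/sP; first exact/polygon_ivec.
apply/hasP; exists u => //.
by move/eqP: uy; rewrite lin_ivec eqr_int.
Qed.

(** * Dimensions, edges and facets *)

(** The differences of three affinely independent points would form an invertible matrix that kills
    the nonzero normal of [t]. *)
Lemma has_dim1 (X : set 'cV[R]_2) t c v w :
  (t.1.1 != 0) || (t.1.2 != 0) -> (forall x, X x -> lin t x = c) ->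
  X v -> X w -> v != w -> has_dim X 1.
Proof.
move=> t0 Xt Xv Xw vw; split.
  exists (fun i => if i == 0 then v else w); split=> [i|]; first by case: ifP.
  rewrite /affinely_independent /row_free rank_rV eqb1.
  apply: contraNneq vw => /matrixP M0; apply/eqP.
  have := M0 0 0; have := M0 0 1; rewrite !mxE /= => e1 e0.
  by apply: col2P; lra.
move=> y yX; apply/negP; rewrite /affinely_independent row_free_unit.
set M := (\matrix_i _) => Mu.
have M0 : M *m vec2 t.1.1%:~R t.1.2%:~R = 0.
  apply/matrixP => i j; rewrite (ord1 j) mxE big_ord_recl big_ord1 !mxE /=.
  have := Xt _ (yX (lift ord0 i)); rewrite -(Xt _ (yX ord0)) /lin.
  rewrite (_ : lift ord0 ord0 = 1 :> 'I_2); last exact: val_inj.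
  by rewrite (_ : ord0 = 0) //; lra.
have := mulKmx Mu (vec2 t.1.1%:~R t.1.2%:~R); rewrite M0 mulmx0 => /matrixP e.
have := e 0 0; have := e 1 0.
rewrite vec2E0 vec2E1 !mxE => /esym/eqP + /esym/eqP.
by rewrite !intr_eq0; case/orP: t0 => /negPf->.
Qed.

Lemma has_dim2 (X : set 'cV[R]_2) (u v w : 'cV[R]_2) :
  X u -> X v -> X w ->
  (v 0 0 - u 0 0) * (w 1 0 - u 1 0) != (v 1 0 - u 1 0) * (w 0 0 - u 0 0) ->
  has_dim X 2.
Proof.
move=> Xu Xv Xw det; split; last first.
  move=> y _; rewrite /affinely_independent /row_free.
  by rewrite ltn_eqF // ltnS rank_leq_col.
exists (fun i => if i == 0 then u else if i == 1 then v else w).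
split=> [i|]; first by do 2?case: ifP.
rewrite /affinely_independent; apply: inj_row_free => x.
move=> /matrixP x0; have := x0 0 0; have := x0 0 1.
rewrite !mxE !big_ord_recl !big_ord0 !mxE /= !addr0.
rewrite (_ : lift _ _ = 1 :> 'I_2); last exact: val_inj.
move: det; rewrite -subr_eq0 => det e1 e0.
apply: trmx_inj; rewrite trmx0; apply: col2P; rewrite !mxE;
  apply: (mulfI det); rewrite mulr0.
  have := congr1 ( *%R (w 1 0 - u 1 0)) e0.
  have := congr1 ( *%R (w 0 0 - u 0 0)) e1.
  rewrite (_ : ord0 = 0) //; lra.
have := congr1 ( *%R (v 1 0 - u 1 0)) e0.
have := congr1 ( *%R (v 0 0 - u 0 0)) e1.
rewrite (_ : ord0 = 0) //; lra.
Qed.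

Lemma tight_edge s t v w : t \in s -> (t.1.1 != 0) || (t.1.2 != 0) ->
  polyhedron (polygon s) v -> polyhedron (polygon s) w ->
  lin t v = t.2%:~R -> lin t w = t.2%:~R -> v != w ->
  edge (polyhedron (polygon s))
    [set x | polyhedron (polygon s) x /\ lin t x = t.2%:~R].
Proof.
move=> ts t0 vP wP tv tw vw; split; last first.
  by apply: (@has_dim1 _ t t.2%:~R v w) => // x [].
split; first by exists v.
exists (\row_j (if j == 0 then t.1.1 else t.1.2)%:~R), t.2%:~R.
split=> [x /polygonP/(_ _ ts)|]; first by rewrite mul_row_lin.
by apply/seteqP; split=> x /=; rewrite mul_row_lin.
Qed.

(** By convexity the segment lies in the face where [t] is tight; [sub] is the other inclusion. *)
Lemma segment_edge s t v w : t \in s -> (t.1.1 != 0) || (t.1.2 != 0) ->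
  polyhedron (polygon s) v -> polyhedron (polygon s) w ->
  lin t v = t.2%:~R -> lin t w = t.2%:~R -> v != w ->
  (forall x, polyhedron (polygon s) x -> lin t x = t.2%:~R -> segment v w x) ->
  edge (polyhedron (polygon s)) (segment v w).
Proof.
move=> ts t0 vP wP tv tw vw sub.
rewrite (_ : segment v w =
  [set x | polyhedron (polygon s) x /\ lin t x = t.2%:~R]).
  exact: (tight_edge ts t0 vP wP tv tw vw).
apply/seteqP; split=> [x [c [/andP[c0 c1] ->]]|x [xP tx]] /=; last exact: sub.
split; last by rewrite linD !linZ tv tw; ring.
apply/polygonP => u us; rewrite linD !linZ.
have /polygonP/(_ _ us) uv := vP; have /polygonP/(_ _ us) uw := wP.
rewrite -[leRHS](_ : (1 - c) * u.2%:~R + c * u.2%:~R = _); last by ring.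
by rewrite lerD // ler_wpM2l // subr_ge0.
Qed.

(** The non-collinear points [p], [q], [r] make the polygon two-dimensional, and two distinct points
    of [W] on each boundary line make every constraint define a facet. *)
Lemma minimal_polygon s (W : seq (int * int)) p q r :
  all (fun t : con => (t.1.1 != 0) || (t.1.2 != 0)) s ->
  all (ipolygon s) [:: p, q, r & W] ->
  (q.1 - p.1) * (r.2 - p.2) != (q.2 - p.2) * (r.1 - p.1) ->
  all (fun t => has (fun a => has (fun b =>
    [&& ilin t a == t.2, ilin t b == t.2 & a != b]) W) W) s ->
  minimal_representation (polygon s).
Proof.
move=> /allP nz /= /and4P[/polygon_ivec pP /polygon_ivec qP /polygon_ivec rP].
move=> /allP WP det /allP sW i.
set t := nth (0, 0, 0) s i; have ts : t \in s by apply: mem_nth.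
have -> : [set x | polyhedron (polygon s) x /\
    @ineqmap R 2 (polygon s) x i 0 = ineqrhs (polygon s) i 0] =
  [set x | polyhedron (polygon s) x /\ lin t x = t.2%:~R].
  by apply/seteqP; split=> x /=; rewrite ineqmap_polygon mxE.
have /hasP[a aW /hasP[b bW /and3P[/eqP ta /eqP tb ab]]] := sW _ ts.
have [|||||F dimF] := @tight_edge s t (ivec a) (ivec b) ts (nz _ ts).
- exact/polygon_ivec/WP.
- exact/polygon_ivec/WP.
- by rewrite lin_ivec ta.
- by rewrite lin_ivec tb.
- apply: contraNneq ab => /matrixP e; have := e 0 0; have := e 1 0.
  rewrite !vec2E0 !vec2E1 => /eqP + /eqP; rewrite !eqr_int.
  by case: (a) (b) => [? ?] [? ?] /= /eqP-> /eqP->.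
split=> //; exists 1%N; split=> //; apply: (has_dim2 pP qP rP).
by rewrite !vec2E0 !vec2E1 -!rmorphB -!rmorphM eqr_int.
Qed.

End Polygon.

(** * The four separating polygons *)

Definition kite : seq con :=
  [:: (-1, 0, 0); (0, -1, 0); (-1, 2, 2); (2, -1, 2)].

Definition trapezoid : seq con :=
  [:: (-1, 0, 0); (0, -1, 0); (0, 1, 1); (1, 1, 2)].

Definition hexagon : seq con :=
  [:: (1, 0, 1); (-1, 0, 1); (0, 1, 1); (0, -1, 1); (1, -1, 1); (-1, 1, 1)].

Definition triangle : seq con := [:: (-1, 0, 0); (0, -1, 0); (1, 1, 1)].

Section Examples.
Variable R : realType.

Lemma kite_minimal : minimal_representation (polygon R kite).
Proof.
exact: (@minimal_polygon R kite [:: (0, 0); (1, 0); (0, 1); (2, 2)]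
  (0, 0) (1, 0) (0, 1)).
Qed.

Lemma trapezoid_minimal : minimal_representation (polygon R trapezoid).
Proof.
exact: (@minimal_polygon R trapezoid [:: (0, 0); (2, 0); (0, 1); (1, 1)]
  (0, 0) (1, 0) (0, 1)).
Qed.

Lemma hexagon_minimal : minimal_representation (polygon R hexagon).
Proof.
exact: (@minimal_polygon R hexagon
  [:: (1, 0); (1, 1); (0, 1); (-1, 0); (-1, -1); (0, -1)]
  (0, 0) (1, 0) (0, 1)).
Qed.

Lemma triangle_minimal : minimal_representation (polygon R triangle).
Proof.
exact: (@minimal_polygon R triangle [:: (0, 0); (1, 0); (0, 1)]
  (0, 0) (1, 0) (0, 1)).
Qed.

(** Two normals have determinant -3, so unimodularity fails; still any two boundary lines meet in a
    lattice point, which computation confirms. *)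
Lemma kite_GCW : GCW (polygon R kite).
Proof. exact: integral_polygon. Qed.

Lemma kite_not_ICW : ~ ICW (polygon R kite).
Proof.
(* The default value of [nth] is the end point of the walk. *)
pose y (i : nat) : 'cV[R]_2 := nth (vec2 2 2) [:: vec2 1 0; vec2 1 (3 / 2)] i.
move=> [_ /(_ 2%N y) wZ].
have /integral_vectorP[[a b] /matrixP/(_ 1 0)] : integral_vector (y 1%N).
  apply: wZ => //; split.
  - rewrite (_ : y 0%N = ivec R (1, 0)); first exact: ivertex_vertex.
    by apply: col2P; rewrite !mxE.
  - rewrite (_ : y 2%N = ivec R (2, 2)); first exact: ivertex_vertex.
    by apply: col2P; rewrite !mxE.
  case=> [|[|//]] _; split.
  - rewrite (_ : y 0%N = ivec R (1, 0)); first exact/polygon_ivec.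
    by apply: col2P; rewrite !mxE.
  (* The direction of the side on the vertical axis; the side through (0,1) and (2,2) blocks it at
     height 3/2, and the next step follows that side. *)
  - exists (ivec R (0, 1)), (3 / 2); split.
    + exact: (@circuit_ivec _ _ (-1, 0, 0)).
    + lra.
    + by apply: col2P; rewrite !mxE /=; lra.
    + move=> c lt_c /polygonP/(_ (-1, 2, 2) isT).
      by rewrite /lin !mxE /=; lra.
  - apply/polygonP => t; rewrite !inE => /or4P[] /eqP->;
      rewrite /lin !mxE /=; lra.
  exists (ivec R (2, 1)), (1 / 2); split.
  - exact: (@circuit_ivec _ _ (-1, 2, 2)).
  - lra.
  - by apply: col2P; rewrite !mxE /=; lra.
  - move=> c lt_c /polygonP/(_ (2, -1, 2) isT).
    by rewrite /lin !mxE /=; lra.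
rewrite !mxE /= => e.
(* An integral height would make 3 even. *)
have /eqP : (3 : int)%:~R = (2 * b)%:~R :> R by rewrite rmorphM /=; lra.
by rewrite eqr_int; lia.
Qed.

Lemma trapezoid_ICW : ICW (polygon R trapezoid).
Proof. exact: unimodular_ICW. Qed.

Lemma trapezoid_not_VCW : ~ VCW (polygon R trapezoid).
Proof.
pose y (i : nat) := ivec R (nth (2, 0) [:: (0, 1); (1, 0)] i).
move=> [_ /(_ 2%N y) wV].
have vtx : vertex (polyhedron (polygon R trapezoid)) (y 1%N).
  apply: wV => //; split; try exact: ivertex_vertex.
  case=> [|[|//]] _; (split; first exact/polygon_ivec).
  - exists (ivec R (1, -1)), 1; split.
    + exact: (@circuit_ivec _ _ (1, 1, 2)).
    + lra.
    + by apply: col2P; rewrite !mxE /=; lra.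
    + move=> c lt_c /polygonP/(_ (0, -1, 0) isT).
      by rewrite /lin !mxE /=; lra.
  exists (ivec R (1, 0)), 1; split.
  - exact: (@circuit_ivec _ _ (0, -1, 0)).
  - lra.
  - by apply: col2P; rewrite !mxE /=; lra.
  - move=> c lt_c /polygonP/(_ (1, 1, 2) isT).
    by rewrite /lin !mxE /=; lra.
(* The point (1,0) is the midpoint of (0,0) and (2,0), so it cannot be a vertex. *)
have : [set y 1%N] (y 1%N + ivec R (1, 0)).
  apply: (face_midpoint vtx) => //; apply/polygonP => t;
    by rewrite !inE => /or4P[] /eqP->; rewrite /lin !mxE /=; lra.
by move=> /matrixP/(_ 0 0); rewrite !mxE /=; lra.
Qed.

(** Of the nine lattice points of the square, (1,-1) and (-1,1) are cut off, the origin is tight for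
    no constraint, and the other six are vertices. *)
Lemma hexagon_VCW : VCW (polygon R hexagon).
Proof.
apply: unimodular_VCW => // -[a b] hP hT.
have ha : [|| a == -1, a == 0 | a == 1].
  by move: hP; rewrite /ipolygon /ilin /=; lia.
have hb : [|| b == -1, b == 0 | b == 1].
  by move: hP; rewrite /ipolygon /ilin /=; lia.
by move: hP hT; case/or3P: ha => /eqP->; case/or3P: hb => /eqP->.
Qed.

Lemma hexagon_not_ECW : ~ ECW (polygon R hexagon).
Proof.
pose y (i : nat) := ivec R (nth (-1, -1) [:: (1, 1)] i).
move=> [_ /(_ 1%N y) wE].
have [|_ /(_ 0%N isT)[fS _]] := wE.
  split; try exact: ivertex_vertex.
  case=> // _; split; first exact/polygon_ivec.
  exists (ivec R (-1, -1)), 2; split.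
  - exact: (@circuit_ivec _ _ (1, -1, 1)).
  - lra.
  - by apply: col2P; rewrite !mxE /=; lra.
  - move=> c lt_c /polygonP/(_ (-1, 0, 1) isT).
    by rewrite /lin !mxE /=; lra.
(* The origin lies on the diagonal and is the midpoint of (1,0) and (-1,0); were the diagonal a
   face, it would contain (1,0). *)
have : segment (y 0%N) (y 1%N) (ivec R (0, 0) + ivec R (1, 0)).
  apply: (face_midpoint fS).
  - by exists (1 / 2); split; [lra | apply: col2P; rewrite !mxE /=; lra].
  - rewrite (_ : _ + _ = ivec R (1, 0)); first exact/polygon_ivec.
    by apply: col2P; rewrite !mxE /=; lra.
  - rewrite (_ : _ - _ = ivec R (-1, 0)); first exact/polygon_ivec.
    by apply: col2P; rewrite !mxE /=; lra.
case=> c [_ /matrixP e]; have := e 0 0; have := e 1 0.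
by rewrite !mxE /=; lra.
Qed.

Lemma triangle_integral p : ipolygon triangle p ->
  [|| p == (0, 0), p == (1, 0) | p == (0, 1)].
Proof. by case: p => a b; rewrite /ipolygon /ilin !xpair_eqE /=; lia. Qed.

Lemma triangle_VCW : VCW (polygon R triangle).
Proof.
apply: unimodular_VCW => // p /triangle_integral.
by case/or3P=> /eqP->.
Qed.

(** Steps have positive length, so consecutive points are distinct lattice points of the triangle.
    Each of the six ordered pairs is checked to span an edge. *)
Lemma triangle_ECW : ECW (polygon R triangle).
Proof.
have [vZ wV] := triangle_VCW; split=> // k y yW.
split=> [|i lt_ik]; first exact: wV.
have yP j : (j <= k)%N -> exists2 p, y j = ivec R p &
    [|| p == (0, 0), p == (1, 0) | p == (0, 1)].
  move=> le_jk; have vtx := wV _ _ yW _ le_jk.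
  have /integral_vectorP[p yp] := vZ _ vtx; exists p => //.
  apply: triangle_integral; apply/(polygon_ivec R).
  by rewrite -yp; apply: vertex_mem.
have ne : y i != y i.+1.
  have [g [a [t [_ [a0 ->] _ tg _]]]] := circuit_walk_step yW lt_ik.
  apply/eqP => /(congr1 (lin t)); rewrite linD linZ => /eqP.
  by rewrite -subr_eq0 opprD addrA subrr sub0r oppr_eq0 gt_eqF ?mulr_gt0.
have [p yp hp] := yP _ (ltnW lt_ik); have [q yq hq] := yP _ lt_ik.
rewrite {}yp {}yq {yP} in ne *.
(* Here [t] is the side through [p] and [q], and [c x] is the parameter of [x] on the segment from
   [p] to [q]. *)
have E t (c : 'cV[R]_2 -> R) : t \in triangle ->
    [&& ipolygon triangle p, ipolygon triangle q,
        ilin t p == t.2 & ilin t q == t.2] ->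
    (forall x : 'cV[R]_2, x 0 0 >= 0 -> x 1 0 >= 0 -> x 0 0 + x 1 0 <= 1 ->
       lin t x = t.2%:~R ->
       0 <= c x <= 1 /\ x = (1 - c x) *: ivec R p + c x *: ivec R q) ->
    edge (polyhedron (polygon R triangle)) (segment (ivec R p) (ivec R q)).
  move=> ts /and4P[/polygon_ivec pP /polygon_ivec qP /eqP tp /eqP tq] h.
  apply: (segment_edge ts _ (pP R) (qP R)); rewrite ?lin_ivec ?tp ?tq //.
    by move: ts; rewrite !inE => /or3P[] /eqP->.
  move=> x /polygonP xP xt; exists (c x); apply: h => //.
  - by have := xP (-1, 0, 0) isT; rewrite /lin /=; lra.
  - by have := xP (0, -1, 0) isT; rewrite /lin /=; lra.
  - by have := xP (1, 1, 1) isT; rewrite /lin /=; lra.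
case/or3P: hp => /eqP p_eq; case/or3P: hq => /eqP q_eq;
  rewrite p_eq q_eq ?eqxx // in ne E *.
- apply: (E (0, -1, 0) (fun x => x 0 0)) => // x x0 x1 x01; rewrite /lin /= => xt.
  by split; [|apply: col2P; rewrite !mxE /=]; lra.
- apply: (E (-1, 0, 0) (fun x => x 1 0)) => // x x0 x1 x01; rewrite /lin /= => xt.
  by split; [|apply: col2P; rewrite !mxE /=]; lra.
- apply: (E (0, -1, 0) (fun x => 1 - x 0 0)) => // x x0 x1 x01; rewrite /lin /= => xt.
  by split; [|apply: col2P; rewrite !mxE /=]; lra.
- apply: (E (1, 1, 1) (fun x => x 1 0)) => // x x0 x1 x01; rewrite /lin /= => xt.
  by split; [|apply: col2P; rewrite !mxE /=]; lra.
- apply: (E (-1, 0, 0) (fun x => 1 - x 1 0)) => // x x0 x1 x01; rewrite /lin /= => xt.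
  by split; [|apply: col2P; rewrite !mxE /=]; lra.
- apply: (E (1, 1, 1) (fun x => x 0 0)) => // x x0 x1 x01; rewrite /lin /= => xt.
  by split; [|apply: col2P; rewrite !mxE /=]; lra.
Qed.

End Examples.

Theorem theorem1 (R : realType) :
  (forall (n : nat) (P : hrep R n),
     [/\ ECW P -> VCW P, VCW P -> ICW P & ICW P -> GCW P]) /\
  [/\ exists (n : nat) (P : hrep R n),
        [/\ minimal_representation P, GCW P & ~ ICW P],
      exists (n : nat) (P : hrep R n),
        [/\ minimal_representation P, ICW P & ~ VCW P],
      exists (n : nat) (P : hrep R n),
        [/\ minimal_representation P, VCW P & ~ ECW P]
    & exists (n : nat) (P : hrep R n),
        minimal_representation P /\ ECW P].
Proof.
split=> [n P|].
  split=> [[vZ wE]|[vZ wV]|[] //].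
  - by split=> // k y /wE[].
  (* The points of a vertex walk are vertices, hence integral. *)
  - by split=> // k y yW i le_ik; apply/vZ/(wV _ _ yW).
split.
- exists 2%N, (polygon R kite); split.
  + exact: kite_minimal.
  + exact: kite_GCW.
  + exact: kite_not_ICW.
- exists 2%N, (polygon R trapezoid); split.
  + exact: trapezoid_minimal.
  + exact: trapezoid_ICW.
  + exact: trapezoid_not_VCW.
- exists 2%N, (polygon R hexagon); split.
  + exact: hexagon_minimal.
  + exact: hexagon_VCW.
  + exact: hexagon_not_ECW.
- exists 2%N, (polygon R triangle); split.
  + exact: triangle_minimal.
  + exact: triangle_ECW.
Qed.
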